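(* Let $\mathcal C,\mathcal M,\mathcal N$ be categories and let $I:\mathcal M\to\mathcal C$, $M:\mathcal C\to\mathcal M$, $N:\mathcal C\to\mathcal N$, $J:\mathcal N\to\mathcal C$ be functors with adjunctions $N\dashv J$ (with unit $\theta:1_{\mathcal C}\to JN$) and $I\dashv M$ (with counit $\psi:IM\to 1_{\mathcal C}$). Then the composite adjunction $NI\dashv MJ$ is an adjoint equivalence if and only if both of the following hold: (1) for each object $x$ of $\mathcal M$, $(x,\theta_{Ix})$ is a final object in the comma category $I\downarrow JNIx$; (2) for each object $y$ of $\mathcal N$, $(y,\psi_{Jy})$ is an initial object in the comma category $IMJy\downarrow J$.
   Context: An adjunction is called an adjoint equivalence if both its unit and its counit are natural isomorphisms. For a functor $G:\mathcal D\to\mathcal C$ and an object $c$ of $\mathcal C$: the comma category $c\downarrow G$ has as objects pairs $(y,f)$ with $y\in\mathcal D$ and $f:c\to Gy$ in $\mathcal C$, and a morphism $h:(y,f)\to(z,g)$ is $h:y\to z$ in $\mathcal D$ with $(Gh)\circ f=g$. Dually, $G\downarrow c$ has as objects pairs $(y,f)$ with $f:Gy\to c$, and a morphism $h:(y,f)\to(z,g)$ is $h:y\to z$ in $\mathcal D$ with $g\circ(Gh)=f$. The composite adjunction $NI\dashv MJ$ has unit with components $(M\theta_{Ix})\circ\sigma_x$ and counit with components $\rho_y\circ(N\psi_{Jy})$, where $\sigma$ is the unit of $I\dashv M$ and $\rho$ is the counit of $N\dashv J$. *)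

(* Defs.v *)
From Stdlib Require Import ProofIrrelevance.

Set Implicit Arguments.
Unset Strict Implicit.
Unset Printing Implicit Defensive.

Declare Scope cat_scope.
Delimit Scope cat_scope with cat.
Open Scope cat_scope.

Record category := Category {
  obj :> Type;
  hom : obj -> obj -> Type;
  idm : forall a : obj, hom a a;
  comp : forall a b c : obj, hom b c -> hom a b -> hom a c;
  comp_idl : forall (a b : obj) (f : hom a b), comp (idm b) f = f;
  comp_idr : forall (a b : obj) (f : hom a b), comp f (idm a) = f;
  compA : forall (a b c d : obj) (h : hom c d) (g : hom b c) (f : hom a b),
    comp h (comp g f) = comp (comp h g) f
}.

Arguments hom {_} _ _.
Arguments idm {_} _.
Arguments comp {_} {_ _ _} _ _.

Notation "g ∘ f" := (comp g f) (at level 40, left associativity) : cat_scope.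

Definition is_iso (C : category) (a b : C) (f : hom a b) : Prop :=
  exists g : hom b a, g ∘ f = idm a /\ f ∘ g = idm b.

Definition is_initial (C : category) (a : C) : Prop :=
  forall z : C, exists h : hom a z, forall k : hom a z, k = h.

Definition is_final (C : category) (a : C) : Prop :=
  forall z : C, exists h : hom z a, forall k : hom z a, k = h.

Arguments is_initial C a : clear implicits.
Arguments is_final C a : clear implicits.

Record functor (C D : category) := Functor {
  fobj :> C -> D;
  fmap : forall a b : C, hom a b -> hom (fobj a) (fobj b);
  fmap_id : forall a : C, fmap (idm a) = idm (fobj a);
  fmap_comp : forall (a b c : C) (g : hom b c) (f : hom a b),
    fmap (g ∘ f) = fmap g ∘ fmap f
}.

Arguments fmap {_ _} _ {_ _} _.

Definition functor_id (C : category) : functor C C :=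
  @Functor C C (fun a => a) (fun _ _ f => f)
    (fun _ => eq_refl) (fun _ _ _ _ _ => eq_refl).

Definition functor_comp (C D E : category) (G : functor D E) (F : functor C D) :
  functor C E.
Proof.
refine (@Functor C E (fun a => G (F a)) (fun _ _ f => fmap G (fmap F f)) _ _).
- intros a. now rewrite !fmap_id.
- intros a b c g f. now rewrite !fmap_comp.
Defined.

Record nat_trans (C D : category) (F G : functor C D) := NatTrans {
  component :> forall a : C, hom (F a) (G a);
  naturality : forall (a b : C) (f : hom a b),
    component b ∘ fmap F f = fmap G f ∘ component a
}.

Definition is_nat_iso (C D : category) (F G : functor C D)
  (alpha : nat_trans F G) : Prop :=
  forall a : C, is_iso (alpha a).

(* [adjunction F G] is the data of an adjunction F -| G, with F the left adjoint. *)
Record adjunction (C D : category) (F : functor C D) (G : functor D C) := Adjunction {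
  adj_unit : nat_trans (functor_id C) (functor_comp G F);
  adj_counit : nat_trans (functor_comp F G) (functor_id D);
  triangle_l : forall a : C, adj_counit (F a) ∘ fmap F (adj_unit a) = idm (F a);
  triangle_r : forall b : D, fmap G (adj_counit b) ∘ adj_unit (G b) = idm (G b)
}.

Definition is_adjoint_equivalence (C D : category) (F : functor C D)
  (G : functor D C) (A : adjunction F G) : Prop :=
  is_nat_iso (adj_unit A) /\ is_nat_iso (adj_counit A).

Definition comp_unit (C D E : category)
  (F : functor C D) (G : functor D C) (A : adjunction F G)
  (F' : functor D E) (G' : functor E D) (A' : adjunction F' G') :
  nat_trans (functor_id C) (functor_comp (functor_comp G G') (functor_comp F' F)).
Proof.
refine (@NatTrans C C (functor_id C)
  (functor_comp (functor_comp G G') (functor_comp F' F))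
  (fun x : C => fmap G (adj_unit A' (F x)) ∘ adj_unit A x) _).
intros a b f; simpl.
pose proof (naturality (adj_unit A) f) as H.
pose proof (naturality (adj_unit A') (fmap F f)) as H'.
simpl in H, H'.
now rewrite <- compA, H, !compA, <- !fmap_comp, H'.
Defined.

Definition comp_counit (C D E : category)
  (F : functor C D) (G : functor D C) (A : adjunction F G)
  (F' : functor D E) (G' : functor E D) (A' : adjunction F' G') :
  nat_trans (functor_comp (functor_comp F' F) (functor_comp G G')) (functor_id E).
Proof.
refine (@NatTrans E E (functor_comp (functor_comp F' F) (functor_comp G G'))
  (functor_id E) (fun y : E => adj_counit A' y ∘ fmap F' (adj_counit A (G' y))) _).
intros a b f; simpl.
pose proof (naturality (adj_counit A') f) as H'.
pose proof (naturality (adj_counit A) (fmap G' f)) as H.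
simpl in H, H'.
now rewrite <- compA, <- fmap_comp, H, fmap_comp, !compA, H'.
Defined.

Definition adjunction_comp (C D E : category)
  (F : functor C D) (G : functor D C) (A : adjunction F G)
  (F' : functor D E) (G' : functor E D) (A' : adjunction F' G') :
  adjunction (functor_comp F' F) (functor_comp G G').
Proof.
refine (@Adjunction C E (functor_comp F' F) (functor_comp G G')
  (comp_unit A A') (comp_counit A A') _ _).
- intros a; simpl.
  pose proof (naturality (adj_counit A) (adj_unit A' (F a))) as H.
  pose proof (triangle_l A a) as T; pose proof (triangle_l A' (F a)) as T'.
  simpl in H, T, T'.
  now rewrite <- compA, <- fmap_comp, (fmap_comp F), compA, H, <- compA, T, comp_idr.
- intros b; simpl.
  pose proof (naturality (adj_unit A') (adj_counit A (G' b))) as H.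
  pose proof (triangle_r A (G' b)) as T; pose proof (triangle_r A' b) as T'.
  simpl in H, T, T'.
  now rewrite compA, <- fmap_comp, (fmap_comp G'), <- compA, <- H, compA, T',
    comp_idl.
Defined.

(* The comma category c ↓ G. *)
Record under_obj (C D : category) (c : C) (G : functor D C) := UnderObj {
  under_dom : D;
  under_arr : hom c (G under_dom)
}.

Arguments UnderObj {_ _} c G _ _.

Definition under_hom (C D : category) (c : C) (G : functor D C)
  (s t : under_obj c G) : Type :=
  {h : hom (under_dom s) (under_dom t) | fmap G h ∘ under_arr s = under_arr t}.

Definition comma_under (C D : category) (c : C) (G : functor D C) : category.
Proof.
unshelve refine (@Category (under_obj c G) (@under_hom C D c G) _ _ _ _ _).
- intros s. exists (idm (under_dom s)). now rewrite fmap_id, comp_idl.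
- intros s t u h k. exists (proj1_sig h ∘ proj1_sig k).
  now rewrite fmap_comp, <- compA, (proj2_sig k), (proj2_sig h).
- intros s t [h Hh]. apply subset_eq_compat. apply comp_idl.
- intros s t [h Hh]. apply subset_eq_compat. apply comp_idr.
- intros s t u v h k l. apply subset_eq_compat. apply compA.
Defined.

(* The comma category G ↓ c. *)
Record over_obj (C D : category) (G : functor D C) (c : C) := OverObj {
  over_dom : D;
  over_arr : hom (G over_dom) c
}.

Arguments OverObj {_ _} G c _ _.

Definition over_hom (C D : category) (G : functor D C) (c : C)
  (s t : over_obj G c) : Type :=
  {h : hom (over_dom s) (over_dom t) | over_arr t ∘ fmap G h = over_arr s}.

Definition comma_over (C D : category) (G : functor D C) (c : C) : category.
Proof.
unshelve refine (@Category (over_obj G c) (@over_hom C D G c) _ _ _ _ _).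
- intros s. exists (idm (over_dom s)). now rewrite fmap_id, comp_idr.
- intros s t u h k. exists (proj1_sig h ∘ proj1_sig k).
  now rewrite fmap_comp, compA, (proj2_sig h), (proj2_sig k).
- intros s t [h Hh]. apply subset_eq_compat. apply comp_idl.
- intros s t [h Hh]. apply subset_eq_compat. apply comp_idr.
- intros s t u v h k l. apply subset_eq_compat. apply compA.
Defined.

(* Main.v *)
(** Under the hom-set bijection of [I ⊣ M], the universal property of
    [(x, g : I x -> c)] as a final object of [I ↓ c] says that postcomposition
    with the transpose [x -> M c] of [g] is bijective on every hom-set, i.e. that
    the transpose is an isomorphism. Dually, [(y, f : c -> J y)] is initial in
    [c ↓ J] if and only if the transpose [N c -> y] of [f] is an isomorphism.
    The components of the unit and counit of the composite adjunction are the
    transposes of [θ_{I x}] and of [ψ_{J y}]. *)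

From Stdlib Require Import ProofIrrelevance.
Require Import Defs.

Section Transposition.

Variables (C D : category) (F : functor C D) (G : functor D C).
Variable A : adjunction F G.

Definition transpose_r (a : C) (b : D) (f : hom (F a) b) : hom a (G b) :=
  fmap G f ∘ adj_unit A a.

Definition transpose_l (a : C) (b : D) (g : hom a (G b)) : hom (F a) b :=
  adj_counit A b ∘ fmap F g.

Arguments transpose_r {a b} f.
Arguments transpose_l {a b} g.

Lemma transpose_rK (a : C) (b : D) (f : hom (F a) b) :
  transpose_l (transpose_r f) = f.
Proof.
  unfold transpose_l, transpose_r; simpl.
  pose proof (naturality (adj_counit A) f) as H.
  pose proof (triangle_l A a) as T.
  simpl in H, T.
  now rewrite fmap_comp, compA, H, <- compA, T, comp_idr.
Qed.

Lemma transpose_lK (a : C) (b : D) (g : hom a (G b)) :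
  transpose_r (transpose_l g) = g.
Proof.
  unfold transpose_l, transpose_r; simpl.
  pose proof (naturality (adj_unit A) g) as H.
  pose proof (triangle_r A b) as T.
  simpl in H, T.
  now rewrite fmap_comp, <- compA, <- H, compA, T, comp_idl.
Qed.

(** Naturality of the hom-set bijection in the source; it turns the comma triangle
    [g ∘ fmap F h = f] into [transpose_r g ∘ h = transpose_r f]. *)
Lemma transpose_r_precomp (a a' : C) (b : D) (f : hom (F a) b) (h : hom a' a) :
  transpose_r (f ∘ fmap F h) = transpose_r f ∘ h.
Proof.
  unfold transpose_r; simpl.
  pose proof (naturality (adj_unit A) h) as H.
  simpl in H.
  now rewrite fmap_comp, <- !compA, H.
Qed.

Lemma transpose_l_postcomp (a : C) (b b' : D) (g : hom a (G b)) (h : hom b b') :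
  transpose_l (fmap G h ∘ g) = h ∘ transpose_l g.
Proof.
  unfold transpose_l; simpl.
  pose proof (naturality (adj_counit A) h) as H.
  simpl in H.
  now rewrite fmap_comp, !compA, H.
Qed.

Lemma transpose_r_counit (b : D) : transpose_r (adj_counit A b) = idm (G b).
Proof. exact (triangle_r A b). Qed.

Lemma transpose_l_unit (a : C) : transpose_l (adj_unit A a) = idm (F a).
Proof. exact (triangle_l A a). Qed.

Lemma over_final_iff_transpose_iso (a : C) (b : D) (g : hom (F a) b) :
  is_final (comma_over F b) (OverObj F b a g) <-> is_iso (transpose_r g).
Proof.
  split.
  - intros fin.
    (* The inverse is the mediating map from the counit, since the counit transposes to the identity
       of [G b]. *)
    destruct (fin (OverObj F b (G b) (adj_counit A b))) as [[h Hh] _].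
    simpl in h, Hh.
    exists h; split.
    (* Both [h ∘ transpose_r g] and [idm a] are endomorphisms of the final object, hence equal. *)
    + assert (E : g ∘ fmap F (h ∘ transpose_r g) = g).
      { rewrite fmap_comp, compA, Hh. exact (transpose_rK _ _ g). }
      assert (E1 : g ∘ fmap F (idm a) = g) by now rewrite fmap_id, comp_idr.
      destruct (fin (OverObj F b a g)) as [k Hk].
      exact (f_equal (@proj1_sig _ _)
        (eq_trans (Hk (exist _ _ E)) (eq_sym (Hk (exist _ _ E1))))).
    + rewrite <- transpose_r_precomp, Hh. exact (transpose_r_counit b).
  - intros [v [vu uv]] [z f].
    (* The only solution [k] of [transpose_r g ∘ k = transpose_r f], where [v] inverts
       [transpose_r g]. *)
    assert (E : g ∘ fmap F (v ∘ transpose_r f) = f).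
    { rewrite <- (transpose_rK _ _ (g ∘ _)), transpose_r_precomp, compA, uv, comp_idl.
      apply transpose_rK. }
    unshelve eexists; [exact (exist _ _ E) |].
    intros [k Hk]; simpl in k, Hk.
    apply subset_eq_compat.
    now rewrite <- Hk, transpose_r_precomp, compA, vu, comp_idl.
Qed.

Lemma under_initial_iff_transpose_iso (a : C) (b : D) (f : hom a (G b)) :
  is_initial (comma_under a G) (UnderObj a G b f) <-> is_iso (transpose_l f).
Proof.
  split.
  - intros ini.
    (* Dually, the inverse is the mediating map to the unit, whose transpose is the identity of
       [F a]. *)
    destruct (ini (UnderObj a G (F a) (adj_unit A a))) as [[h Hh] _].
    simpl in h, Hh.
    exists h; split.
    + rewrite <- transpose_l_postcomp, Hh. exact (transpose_l_unit a).
    + assert (E : fmap G (transpose_l f ∘ h) ∘ f = f).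
      { rewrite fmap_comp, <- compA, Hh. exact (transpose_lK _ _ f). }
      assert (E1 : fmap G (idm b) ∘ f = f) by now rewrite fmap_id, comp_idl.
      destruct (ini (UnderObj a G b f)) as [k Hk].
      exact (f_equal (@proj1_sig _ _)
        (eq_trans (Hk (exist _ _ E)) (eq_sym (Hk (exist _ _ E1))))).
  - intros [v [vu uv]] [z g].
    assert (E : fmap G (transpose_l g ∘ v) ∘ f = g).
    { rewrite <- (transpose_lK _ _ (_ ∘ f)), transpose_l_postcomp, <- compA, vu,
        comp_idr.
      apply transpose_lK. }
    unshelve eexists; [exact (exist _ _ E) |].
    intros [k Hk]; simpl in k, Hk.
    apply subset_eq_compat.
    now rewrite <- Hk, transpose_l_postcomp, <- compA, uv, comp_idr.
Qed.

End Transposition.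

Theorem corollary3p2 (calC calM calN : category)
  (I : functor calM calC) (M : functor calC calM)
  (N : functor calC calN) (J : functor calN calC)
  (adjNJ : adjunction N J) (adjIM : adjunction I M) :
  is_adjoint_equivalence (adjunction_comp adjIM adjNJ) <->
  (forall x : calM,
     is_final (comma_over I (J (N (I x))))
       (OverObj I (J (N (I x))) x (adj_unit adjNJ (I x)))) /\
  (forall y : calN,
     is_initial (comma_under (I (M (J y))) J)
       (UnderObj (I (M (J y))) J y (adj_counit adjIM (J y)))).
Proof.
  split.
  - intros [unit_iso counit_iso]; split.
    (* The unit of the composite at [x] is by definition the transpose under [adjIM] of the unit of
       [adjNJ] at [I x], so [exact] closes the goal by conversion. *)
    + intros x. apply (over_final_iff_transpose_iso _ _ _ _ adjIM). exact (unit_iso x).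
    + intros y. apply (under_initial_iff_transpose_iso _ _ _ _ adjNJ).
      exact (counit_iso y).
  - intros [final initial]; split.
    + intros x. exact (proj1 (over_final_iff_transpose_iso _ _ _ _ adjIM _ _ _) (final x)).
    + intros y.
      exact (proj1 (under_initial_iff_transpose_iso _ _ _ _ adjNJ _ _ _) (initial y)).
Qed.
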